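(* For every permutation $\pi \in S_n$, the map $\phi_\pi : \mathbb{R}^{n-1} \to \mathcal{U}^\pi_\Lambda$ is a diffeomorphism with inverse $\psi_\pi : \mathcal{U}^\pi_\Lambda \to \mathbb{R}^{n-1}$.
   Context: Fix real numbers $\lambda_1 < \cdots < \lambda_n$ ($n\ge 2$) and $\Lambda = \operatorname{diag}(\lambda_1,\ldots,\lambda_n)$. Let $\mathcal{T}_\Lambda$ be the set of real symmetric tridiagonal $n\times n$ matrices conjugate to $\Lambda$; it is a compact smooth submanifold, of dimension $n-1$, of the vector space of real symmetric tridiagonal $n \times n$ matrices. $Q^*$ denotes the transpose, $O(n)$ the group of real orthogonal matrices of order $n$. For invertible real $M$, write the unique $QR$ factorization $M = \mathbf{Q}(M)\mathbf{R}(M)$ with $\mathbf{Q}(M)\in O(n)$ and $\mathbf{R}(M)$ upper triangular with positive diagonal. When all leading principal minors of $M$ are nonzero, write the unique $LU$ factorization $M = \mathbf{L}(M)\mathbf{U}(M)$ with $\mathbf{L}(M)$ lower triangular with unit diagonal and $\mathbf{U}(M)$ upper triangular. $M$ is $LU$-positive if this factorization exists and the diagonal entries of $\mathbf{U}(M)$ are positive. For $\pi \in S_n$, let $\lambda^\pi_i = \lambda_{\pi(i)}$ and $\Lambda^\pi = \operatorname{diag}(\lambda^\pi_1,\ldots,\lambda^\pi_n)$. The chart domain $\mathcal{U}^\pi_\Lambda \subset \mathcal{T}_\Lambda$ is the set of $T\in\mathcal{T}_\Lambda$ for which there is an $LU$-positive $Q_\pi \in O(n)$ with $T = Q_\pi^*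 \Lambda^\pi Q_\pi$ (the $\pi$-normalized diagonalization; $Q_\pi$ is unique if it exists). $\mathcal{U}^\pi_\Lambda$ is open in $\mathcal{T}_\Lambda$. Definition of $\phi_\pi$: given $(\beta^\pi_1,\ldots,\beta^\pi_{n-1})\in\mathbb{R}^{n-1}$, let $B_\pi$ be the lower bidiagonal matrix with diagonal entries $(B_\pi)_{i,i} = \lambda^\pi_i$ and subdiagonal entries $(B_\pi)_{i+1,i} = \beta^\pi_i$ (all other entries zero). Let $L_\pi$ be the lower triangular matrix with unit diagonal such that $B_\pi = L_\pi^{-1}\Lambda^\pi L_\pi$. Then $\phi_\pi(\beta^\pi_1,\ldots,\beta^\pi_{n-1}) = \mathbf{Q}(L_\pi)^* \Lambda^\pi \mathbf{Q}(L_\pi)$, which belongs to $\mathcal{U}^\pi_\Lambda$. Definition of $\psi_\pi$: for $T \in \mathcal{U}^\pi_\Lambda$ with $\pi$-normalized diagonalization $T = Q_\pi^*\Lambda^\pi Q_\pi$, let $L_\pi = \mathbf{L}(Q_\pi)$ and $B_\pi = L_\pi^{-1}\Lambda^\pi L_\pi$. The matrix $B_\pi$ is lower bidiagonal with diagonal entries $\lambda^\pi_1,\ldots,\lambda^\pi_n$; set $\beta^\pi_i = (B_\pi)_{i+1,i}$ and $\psi_\pi(T) = (\beta^\pi_1,\ldots,\beta^\pi_{n-1})$. *)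

(* Defs.v *)
From HB Require Import structures.
From mathcomp Require Import all_boot all_order all_fingroup all_algebra.
From mathcomp Require Import all_classical all_reals all_analysis.

Set Implicit Arguments.
Unset Strict Implicit.
Unset Printing Implicit Defensive.

Import Order.TTheory GRing.Theory Num.Theory.
Import numFieldNormedType.Exports.

Local Open Scope classical_set_scope.
Local Open Scope ring_scope.

Section Smooth.
Context {R : realType}.
Implicit Types V W : normedModType R.

(* [U] is meant to be open and [V] finite-dimensional: Frechet
   differentiability together with the C^k regularity of every directional
   derivative is then the usual C^(k+1) regularity. *)
Fixpoint Ck_on V W (k : nat) (U : set V) (f : V -> W) : Prop :=
  if k is k'.+1 then
    (forall x, U x -> differentiable f x) /\
    (forall v : V, Ck_on k' U ('D_v f))
  else forall x, U x -> {for x, continuous f}.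

Definition smooth_on_open V W (U : set V) (f : V -> W) : Prop :=
  forall k, Ck_on k U f.

(* Smoothness of a map defined on an arbitrary subset of a vector space: it
   extends, locally around each point of the subset, to a smooth map on an open
   set of the ambient space.  When [X] is open in an embedded submanifold, this
   is smoothness for the induced manifold structure. *)
Definition smooth_on V W (X : set V) (f : V -> W) : Prop :=
  forall x, X x -> exists (U : set V) (g : V -> W),
    [/\ open U, U x, smooth_on_open U g
      & forall y, X y -> U y -> f y = g y].

Definition diffeomorphism_with_inverse V W (X : set V) (Y : set W)
    (f : V -> W) (g : W -> V) : Prop :=
  [/\ set_fun X Y f /\ set_fun Y X g,
      forall x, X x -> g (f x) = x,
      forall y, Y y -> f (g y) = y,
      smooth_on X f
    & smooth_on Y g].

End Smooth.

Section Factorizations.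
Context {R : realType} {n : nat}.
Implicit Types M Q L U : 'M[R]_n.

Definition orthogonal_mx Q : Prop := Q^T *m Q = 1%:M.

(* [is_trig_mx] is the library's predicate for LOWER triangular matrices. *)
Definition upper_trig_mx U : bool := is_trig_mx U^T.

Definition lower_unitrig_mx L : Prop :=
  is_trig_mx L /\ forall i, L i i = 1.

Definition is_QR M Q U : Prop :=
  [/\ orthogonal_mx Q, upper_trig_mx U, forall i, 0 < U i i & M = Q *m U].

Definition QR_Q M : 'M[R]_n := [get Q | exists U, is_QR M Q U].

Definition is_LU M L U : Prop :=
  [/\ lower_unitrig_mx L, upper_trig_mx U & M = L *m U].

Definition LU_L M : 'M[R]_n := [get L | exists U, is_LU M L U].

Definition LU_positive M : Prop :=
  exists L U, is_LU M L U /\ forall i, 0 < U i i.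

End Factorizations.

(* The order of the matrices is [m.+1], so that R^(n-1) is ['rV[R]_m]. *)
Section Charts.
Context {R : realType} {m : nat}.
Variables (lam : 'I_m.+1 -> R).
Implicit Types (p : 'S_m.+1) (T : 'M[R]_m.+1) (b : 'rV[R]_m).

Definition tridiagonal T : Prop :=
  forall i j : 'I_m.+1, (i.+1 < j)%N || (j.+1 < i)%N -> T i j = 0.

Definition Lambda : 'M[R]_m.+1 := diag_mx (\row_i lam i).

Definition Lambda_perm p : 'M[R]_m.+1 := diag_mx (\row_i lam (p i)).

Definition isospectral : set 'M[R]_m.+1 :=
  [set T | [/\ T^T = T, tridiagonal T
    & exists2 P, P \in unitmx & T = invmx P *m Lambda *m P]].

Definition normalized_diag p T (Q : 'M[R]_m.+1) : Prop :=
  [/\ orthogonal_mx Q, LU_positive Q & T = Q^T *m Lambda_perm p *m Q].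

Definition chart_domain p : set 'M[R]_m.+1 :=
  isospectral `&` [set T | exists Q, normalized_diag p T Q].

(* Positions (k+1, k), for [k : 'I_m], of the subdiagonal. *)
Definition sub_row (k : 'I_m) : 'I_m.+1 := lift ord0 k.
Definition sub_col (k : 'I_m) : 'I_m.+1 := widen_ord (leqnSn m) k.

Definition bidiagonal p b : 'M[R]_m.+1 :=
  Lambda_perm p + \sum_(k < m) b 0 k *: delta_mx (sub_row k) (sub_col k).

Definition phi_L p b : 'M[R]_m.+1 :=
  [get L | lower_unitrig_mx L /\
           bidiagonal p b = invmx L *m Lambda_perm p *m L].

Definition phi p b : 'M[R]_m.+1 :=
  let Q := QR_Q (phi_L p b) in Q^T *m Lambda_perm p *m Q.

Definition psi_Q p T : 'M[R]_m.+1 := [get Q | normalized_diag p T Q].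

Definition psi p T : 'rV[R]_m :=
  let L := LU_L (psi_Q p T) in
  let B := invmx L *m Lambda_perm p *m L in
  \row_k B (sub_row k) (sub_col k).

End Charts.

(* Main.v *)
Require Import Defs.
From mathcomp Require Import all_boot all_order all_fingroup all_algebra.
From mathcomp Require Import all_classical all_reals all_analysis.
From mathcomp Require Import zify ring.

(** Write [D] for the diagonal matrix of the permuted eigenvalues.

    Algebra.  The equation [L B = D L], with [B] bidiagonal, can be solved entry
    by entry, since the diagonal of [D] has no repetition: the unit lower
    triangular [L] is [eigen_L b], whose entries are monomials in [b].  If
    [L = Q U] is its QR factorization, then [Q = L U^-1] is an LU factorization,
    and [T = Q^T D Q = U B U^-1].  Read in this form, [T] vanishes
    below its subdiagonal, so it is tridiagonal because it is symmetric.
    Conversely, if [T = Q^T D Q] with [Q = L U], then [L^-1 D L] is lower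
    triangular and equals [U T U^-1], which vanishes below its subdiagonal; so it
    is bidiagonal.  The two constructions therefore undo each other as soon as
    the choices they make are forced: QR and LU factorizations are unique
    ([QR_uniq], [LU_uniq]), and so are [L] ([conj_unitrig_inj]) and the
    normalized diagonalization ([normalized_diag_uniq]).  All of these reduce to
    the fact that a matrix which is both lower and upper triangular, or which
    commutes with [D], is diagonal.

    Smoothness of [phi].  The triangular QR factor of [L] is the Cholesky factor
    of [L^T L], which is obtained from the entries by sums, products, inverses
    of nonzero functions and square roots of positive ones
    ([smooth_cholesky]).

    Smoothness of [psi].  The corner entries of [L^-1 D L = U T U^-1] are
    [T_(k+1,k) U_(k+1,k+1) / U_(k,k)], so the diagonal of [U] has to be read off
    [T] by a formula that makes sense on a neighbourhood of [T] in the space of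
    all matrices.  The products [U_(0,0) ... U_(k-1,k-1)] are the leading minors
    of [Q].  Their squares are the leading minors of the matrices [Q^T P_k Q],
    where [P_k] is the projection on the first [k] coordinates; and [Q^T P_k Q]
    is the polynomial in [T] which interpolates the indicator function of the
    first [k] eigenvalues.  Hence [psi] is the restriction of a function built
    from polynomials in the entries of [T] by division and square roots
    ([psi_extE]), defined on the open set where these minors are positive. *)

Set Implicit Arguments.
Unset Strict Implicit.
Unset Printing Implicit Defensive.

Import Order.TTheory GRing.Theory Num.Theory.
Import numFieldNormedType.Exports.

Local Open Scope classical_set_scope.
Local Open Scope ring_scope.

(** * Calculus of smooth functions on open sets *)

Section CkCalculus.
Context {R : realType} {V : normedModType R}.
Implicit Types (W : normedModType R) (U : set V) (k : nat).

(** Differentiability is local: [f] and [g] have the same expansion at [x]. *)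
Lemma near_eq_differentiable W (f g : V -> W) (x : V) :
  {near x, f =1 g} -> differentiable f x -> differentiable g x.
Proof.
move=> fg df.
have fgx : f x = g x := nbhs_singleton fg.
have gE : g \o shift x = cst (g x) + 'd f x +o_ 0 id.
  apply/eqaddoP => _/posnumP[e].
  have /eqaddoP/(_ e%:num (ltac:(by []))) := diff_locally df.
  have : \forall y \near (0 : V), f (y + x) = g (y + x).
    by rewrite (near_shift x 0) sub0r /=; near do rewrite /= subrK.
  by apply: filterS2 => y /= fgy; rewrite !fctE /= fgy fgx.
have dg : 'd g x = 'd f x :> (V -> W).
  by apply: diff_unique gE; exact: diff_continuous.
by apply/diff_locallyP; rewrite dg; split=> //; exact: diff_continuous.
Unshelve. all: by end_near. Qed.

Lemma Ck_onW W k U (f : V -> W) : Ck_on k.+1 U f -> Ck_on k U f.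
Proof.
elim: k f => [|k IH] f /= [df Df]; first by move=> x /df /differentiable_continuous.
split=> // v; apply: IH; exact: Df.
Qed.

(** Being C^k is local too; this is what allows every derivative below to be
    replaced by its expression on [U], where alone the rules of calculus apply. *)
Lemma eq_Ck_on W k U (f g : V -> W) :
  open U -> (forall x, U x -> f x = g x) -> Ck_on k U f -> Ck_on k U g.
Proof.
move=> oU; elim: k f g => [|k IH] f g fg.
  move=> cf x Ux; suff: g @ x --> g x by [].
  rewrite -(fg x Ux).
  apply: cvg_trans (cf x Ux).
  apply: near_eq_cvg; move: (open_nbhs_nbhs (conj oU Ux)).
  by apply: filterS => y /fg.
have fgn x : U x -> {near x, f =1 g}.
  by move=> Ux; move: (open_nbhs_nbhs (conj oU Ux)); apply: filterS => y /fg.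
move=> /= [df Df]; split=> [x Ux|v].
  exact: near_eq_differentiable (fgn x Ux) (df x Ux).
apply: IH (Df v) => x Ux; exact/near_eq_derive/fgn.
Qed.

Lemma Ck_on_cst W k U (c : W) : Ck_on k U (cst c : V -> W).
Proof.
elim: k c => [|k IH] c /=; first by move=> x _; exact: cst_continuous.
split=> [x _|v]; first exact: differentiable_cst.
suff -> : 'D_v (cst c : V -> W) = cst 0 by exact: IH.
by apply/funext => x; rewrite derive_cst.
Qed.

Lemma Ck_onD W k U (f g : V -> W) :
  open U -> Ck_on k U f -> Ck_on k U g -> Ck_on k U (f + g).
Proof.
move=> oU; elim: k f g => [|k IH] f g.
  by move=> cf cg x Ux; apply: continuousD; [exact: cf|exact: cg].
move=> /= [df Df] [dg Dg]; split=> [x Ux|v].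
  by apply: differentiableD; [exact: df|exact: dg].
apply: (eq_Ck_on oU _ (IH _ _ (Df v) (Dg v))) => x Ux.
by rewrite deriveD //; apply: diff_derivable; [exact: df|exact: dg].
Qed.

Lemma Ck_onM k U (f g : V -> R) :
  open U -> Ck_on k U f -> Ck_on k U g -> Ck_on k U (f * g).
Proof.
move=> oU; elim: k f g => [|k IH] f g.
  by move=> cf cg x Ux; apply: continuousM; [exact: cf|exact: cg].
move=> cf cg; have cf' := Ck_onW cf; have cg' := Ck_onW cg.
case: cf cg => /= [df Df] [dg Dg]; split=> [x Ux|v].
  by apply: differentiableM; [exact: df|exact: dg].
apply: (eq_Ck_on oU _ (Ck_onD oU (IH _ _ cf' (Dg v)) (IH _ _ cg' (Df v)))).
move=> x Ux; rewrite [RHS]deriveM //; apply: diff_derivable; [exact: df|exact: dg].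
Qed.

Lemma Ck_onZl W k U (f : V -> R) (w : W) :
  open U -> Ck_on k U f -> Ck_on k U (fun x => f x *: w).
Proof.
move=> oU; elim: k f => [|k IH] f.
  by move=> cf x Ux; apply: continuousZl; exact: cf.
move=> /= [df Df]; split=> [x Ux|v]; first exact/differentiableZl/df.
apply: (eq_Ck_on oU _ (IH _ (Df v))) => x Ux.
have dfx := df _ Ux.
by rewrite !deriveE ?diffZl //; exact: differentiableZl.
Qed.

(** The derivative of an inverse is a product of functions that are C^k by
    induction, one of which is the inverse itself. *)
Lemma Ck_onV k U (f : V -> R) :
  open U -> (forall x, U x -> f x != 0) -> Ck_on k U f ->
  Ck_on k U (fun x => (f x)^-1).
Proof.
move=> oU f0; elim: k => [|k IH].
  by move=> cf x Ux; apply: continuousV; [exact: f0|exact: cf].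
move=> cf; have cfi := IH (Ck_onW cf).
case: cf => /= [df Df]; split=> [x Ux|v].
  by apply: differentiableV; [exact: df|exact: f0].
have cm1 : Ck_on k U (cst (-1) : V -> R) by exact: Ck_on_cst.
apply: (eq_Ck_on oU _ (Ck_onM oU (Ck_onM oU cm1 (Df v)) (Ck_onM oU cfi cfi))).
move=> x Ux; rewrite deriveV; [|exact: f0|exact/diff_derivable/df].
by rewrite !fctE mulN1r /GRing.scale /= -expr2 exprVn mulrC mulrN mulNr.
Qed.

Lemma derive_comp_real (f : V -> R) (g : R -> R) x v :
  differentiable f x -> differentiable g (f x) ->
  'D_v (fun y => g (f y)) x = 'D_1 g (f x) * 'D_v f x.
Proof.
move=> df dg; rewrite !deriveE //; last exact: differentiable_comp.
rewrite (diff_comp df dg) /= -[X in 'd g _ X]mulr1 -/('d f x v *: 1).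
by rewrite linearZ /GRing.scale /= mulrC -deriveE.
Qed.

Lemma Ck_on_sqrt k U (f : V -> R) :
  open U -> (forall x, U x -> 0 < f x) -> Ck_on k U f ->
  Ck_on k U (fun x => Num.sqrt (f x)).
Proof.
move=> oU f0; elim: k => [|k IH].
  move=> cf x Ux; apply: (@continuous_comp _ _ _ f Num.sqrt); first exact: cf.
  exact: sqrt_continuous.
move=> cf; have cs := IH (Ck_onW cf).
have dsqrt (y : R) : 0 < y -> differentiable (@Num.sqrt R) y.
  move=> y0; apply/derivable1_diffP.
  by have [] := is_derive1_sqrt y0.
case: cf => /= [df Df]; split=> [x Ux|v].
  apply: (@differentiable_comp _ _ _ _ f Num.sqrt); first exact: df.
  exact/dsqrt/f0.
have c2 : Ck_on k U (cst 2 : V -> R) by exact: Ck_on_cst.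
have c2s := Ck_onM oU c2 cs.
have c2s0 x : U x -> (cst 2 * (fun x => Num.sqrt (f x))) x != 0.
  by move=> Ux; rewrite fctE /= mulf_neq0 // gt_eqF // sqrtr_gt0 f0.
apply: (eq_Ck_on oU _ (Ck_onM oU (Df v) (Ck_onV oU c2s0 c2s))) => x Ux.
have dfx := df _ Ux; have dsx := dsqrt _ (f0 _ Ux).
rewrite !fctE /=.
by rewrite derive_comp_real // derive_sqrt ?f0 // mulrC deriveE.
Qed.

Lemma smooth_cst W U (c : W) : smooth_on_open U (fun _ : V => c).
Proof. by move=> k; exact: Ck_on_cst. Qed.

Lemma eq_smooth W U (f g : V -> W) : open U -> (forall x, U x -> f x = g x) ->
  smooth_on_open U f -> smooth_on_open U g.
Proof. by move=> oU fg sf k; exact: eq_Ck_on oU fg (sf k). Qed.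

Lemma smoothD W U (f g : V -> W) : open U ->
  smooth_on_open U f -> smooth_on_open U g ->
  smooth_on_open U (fun x => f x + g x).
Proof. by move=> oU sf sg k; exact: Ck_onD. Qed.

Lemma smoothM U (f g : V -> R) : open U ->
  smooth_on_open U f -> smooth_on_open U g ->
  smooth_on_open U (fun x => f x * g x).
Proof. by move=> oU sf sg k; exact: Ck_onM. Qed.

Lemma smoothZl W U (f : V -> R) (w : W) : open U ->
  smooth_on_open U f -> smooth_on_open U (fun x => f x *: w).
Proof. by move=> oU sf k; exact: Ck_onZl. Qed.

Lemma smoothV U (f : V -> R) : open U -> (forall x, U x -> f x != 0) ->
  smooth_on_open U f -> smooth_on_open U (fun x => (f x)^-1).
Proof. by move=> oU f0 sf k; exact: Ck_onV. Qed.

Lemma smooth_sqrt U (f : V -> R) : open U -> (forall x, U x -> 0 < f x) ->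
  smooth_on_open U f -> smooth_on_open U (fun x => Num.sqrt (f x)).
Proof. by move=> oU f0 sf k; exact: Ck_on_sqrt. Qed.

Lemma smooth_sum W U (I : Type) (r : seq I) (P : pred I) (F : I -> V -> W) :
  open U -> (forall i, P i -> smooth_on_open U (F i)) ->
  smooth_on_open U (fun x => \sum_(i <- r | P i) F i x).
Proof.
move=> oU sF; elim: r => [|i r IH].
  by under eq_fun do rewrite big_nil; exact: smooth_cst.
under eq_fun do rewrite big_cons.
by case Pi: (P i) => //; apply: smoothD => //; exact: sF.
Qed.

Lemma smooth_prod U (I : Type) (r : seq I) (P : pred I) (F : I -> V -> R) :
  open U -> (forall i, P i -> smooth_on_open U (F i)) ->
  smooth_on_open U (fun x => \prod_(i <- r | P i) F i x).
Proof.
move=> oU sF; elim: r => [|i r IH].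
  by under eq_fun do rewrite big_nil; exact: smooth_cst.
under eq_fun do rewrite big_cons.
by case Pi: (P i) => //; apply: smoothM => //; exact: sF.
Qed.

End CkCalculus.

(** * Smooth matrix-valued functions *)

Section SmoothMatrices.
Context {R : realType}.

Lemma smooth_coord m n (U : set 'M[R]_(m, n)) i j :
  smooth_on_open U (fun A => A i j).
Proof.
have Dc (v : 'M[R]_(m, n)) : 'D_v (fun A : 'M[R]_(m, n) => A i j) = cst (v i j).
  apply/funext => A.
  have dA : derivable (id : 'M[R]_(m, n) -> _) A v by exact: derivable_id.
  have := derive_mx dA; rewrite derive_id => /matrixP/(_ i j).
  by rewrite mxE => <-.
case=> [|k]; first by move=> A _; exact: coord_continuous.
split=> [A _|v]; first exact: differentiable_coord.
by rewrite Dc; exact: Ck_on_cst.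
Qed.

Context {V : normedModType R}.
Variable U : set V.
Hypothesis oU : open U.

Definition smooth_entries m n (A : V -> 'M[R]_(m, n)) :=
  forall i j, smooth_on_open U (fun x => A x i j).

(** A matrix is the combination of the elementary matrices with its entries as
    coefficients, so entrywise smoothness is enough. *)
Lemma smooth_mx m n (A : V -> 'M[R]_(m, n)) :
  smooth_entries A -> smooth_on_open U A.
Proof.
move=> sA.
apply: (@eq_smooth _ _ _ _ (fun x => \sum_i \sum_j A x i j *: delta_mx i j)) => //.
  by move=> x _; rewrite -matrix_sum_delta.
by apply: smooth_sum => // i _; apply: smooth_sum => // j _; exact: smoothZl.
Qed.

Lemma smooth_cst_mx m n (A : 'M[R]_(m, n)) : smooth_entries (fun=> A).
Proof. by move=> i j; exact: smooth_cst. Qed.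

Lemma smooth_mulmx m n p (A : V -> 'M[R]_(m, n)) (B : V -> 'M[R]_(n, p)) :
  smooth_entries A -> smooth_entries B -> smooth_entries (fun x => A x *m B x).
Proof.
move=> sA sB i j; under eq_fun do rewrite mxE.
by apply: smooth_sum => // l _; exact: smoothM.
Qed.

Lemma smooth_addmx m n (A B : V -> 'M[R]_(m, n)) :
  smooth_entries A -> smooth_entries B -> smooth_entries (fun x => A x + B x).
Proof. by move=> sA sB i j; under eq_fun do rewrite mxE; exact: smoothD. Qed.

Lemma smooth_scalemx m n (c : V -> R) (A : V -> 'M[R]_(m, n)) :
  smooth_on_open U c -> smooth_entries A ->
  smooth_entries (fun x => c x *: A x).
Proof. by move=> sc sA i j; under eq_fun do rewrite mxE; exact: smoothM. Qed.

Lemma smooth_trmx m n (A : V -> 'M[R]_(m, n)) :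
  smooth_entries A -> smooth_entries (fun x => (A x)^T).
Proof. by move=> sA i j; under eq_fun do rewrite mxE; exact: sA. Qed.

Lemma smooth_det n (A : V -> 'M[R]_n) :
  smooth_entries A -> smooth_on_open U (fun x => \det (A x)).
Proof.
move=> sA; apply: smooth_sum => // s _; apply: smoothM => //.
  exact: smooth_cst.
exact: smooth_prod.
Qed.

(** Cramer's rule. *)
Lemma smooth_invmx n (A : V -> 'M[R]_n) :
  (forall x, U x -> A x \in unitmx) ->
  smooth_entries A -> smooth_entries (fun x => invmx (A x)).
Proof.
move=> uA sA i j.
apply: (@eq_smooth _ _ _ _ (fun x => (\det (A x))^-1 * cofactor (A x) j i)) => //.
  by move=> x Ux; rewrite /invmx /= (uA x Ux) !mxE.
apply: smoothM => //.
  by apply: smoothV => // [x Ux|]; [rewrite -unitfE; exact: uA|exact: smooth_det].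
apply: smoothM => //; first exact: smooth_cst.
apply: smooth_det => k l; under eq_fun do rewrite !mxE; exact: sA.
Qed.

End SmoothMatrices.

(** * Band matrices and triangular matrices *)

Section BandMatrices.
Context {R : realType} {n : nat}.
Implicit Types A B L X : 'M[R]_n.

(** Bandwidth 0 means upper triangular and bandwidth 1 upper Hessenberg, so that
    the additivity of bandwidths under products treats both at once. *)
Definition lower_bandwidth (c : nat) A :=
  forall i j : 'I_n, (j + c < i)%N -> A i j = 0.

Lemma lower_bandwidthM a b A B : lower_bandwidth a A -> lower_bandwidth b B ->
  lower_bandwidth (a + b) (A *m B).
Proof.
move=> hA hB i j ltji; rewrite mxE big1 // => l _.
have [lt_l|le_l] := ltnP (j + b) l; first by rewrite hB ?mulr0.
by rewrite hA ?mul0r //; lia.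
Qed.

(** On the extreme subdiagonal of a product a single term survives.  Bandwidths
    (0, 0) give the diagonal of a product of triangular matrices, (0, 1) and
    (1, 0) the subdiagonal of a conjugate of a Hessenberg matrix. *)
Lemma band_corner_mulmx a b A B (i l j : 'I_n) :
  lower_bandwidth a A -> lower_bandwidth b B ->
  i = (l + a)%N :> nat -> l = (j + b)%N :> nat ->
  (A *m B) i j = A i l * B l j.
Proof.
move=> hA hB il lj; rewrite mxE (bigD1 l) //= big1 ?addr0 // => k k_l.
have {}k_l : (k : nat) != l by [].
have [lt_k|le_k] := ltnP (j + b) k; first by rewrite hB ?mulr0.
by rewrite hA ?mul0r //; lia.
Qed.

Lemma upper_trig_band A : upper_trig_mx A <-> lower_bandwidth 0 A.
Proof.
split=> [/is_trig_mxP uA i j|bA].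
  by rewrite addn0 => /uA; rewrite mxE.
by apply/is_trig_mxP => i j ij; rewrite mxE bA // addn0.
Qed.

Lemma is_trig_mxT A : is_trig_mx A = upper_trig_mx A^T.
Proof. by rewrite /upper_trig_mx trmxK. Qed.

Lemma upper_trigM A B :
  upper_trig_mx A -> upper_trig_mx B -> upper_trig_mx (A *m B).
Proof.
move=> /upper_trig_band uA /upper_trig_band uB.
exact/upper_trig_band/(lower_bandwidthM uA uB).
Qed.

Lemma upper_trig_diagM A B i : upper_trig_mx A -> upper_trig_mx B ->
  (A *m B) i i = A i i * B i i.
Proof.
move=> /upper_trig_band uA /upper_trig_band uB.
by rewrite (band_corner_mulmx uA uB (l := i)) ?addn0.
Qed.

Lemma upper_trig_unit A : upper_trig_mx A -> (forall i, A i i != 0) ->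
  A \in unitmx.
Proof.
move=> uA A0; rewrite unitmxE unitfE -det_tr det_trig // prodf_seq_neq0.
by apply/allP => i _ /=; rewrite mxE A0.
Qed.

(** Comparing the columns of [X A = 1] from left to right forces the entries of
    [X] under the diagonal to vanish. *)
Lemma upper_trigV A : upper_trig_mx A -> (forall i, A i i != 0) ->
  upper_trig_mx (invmx A) /\ forall i, invmx A i i = (A i i)^-1.
Proof.
move=> uA A0; have unA := upper_trig_unit uA A0.
have hA := (upper_trig_band A).1 uA.
have XA := mulVmx unA; set X := invmx A in XA *.
have uX : upper_trig_mx X.
  apply/upper_trig_band => i j; rewrite addn0.
  have [k] := ubnP (j : nat); elim: k j => // k IH j jk ji.
  have /matrixP/(_ i j) := XA; rewrite !mxE (bigD1 j) //= big1 => [|l l_j].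
    have -> : (i == j) = false by apply/eqP => ij; rewrite ij ltnn in ji.
    by rewrite addr0 => /eqP; rewrite mulf_eq0 (negbTE (A0 j)) orbF => /eqP.
  have {}l_j : (l : nat) != j by [].
  have [lt_l|le_l] := ltnP l j; last by rewrite hA ?mulr0 //; lia.
  by rewrite IH ?mul0r //; lia.
split=> // i; apply: (mulIf (A0 i)).
by rewrite -upper_trig_diagM // XA mxE eqxx mulVf.
Qed.

Lemma lower_unitrig_unit L :
  is_trig_mx L -> (forall i, L i i = 1) -> L \in unitmx.
Proof.
by move=> tL L1; rewrite unitmxE det_trig // big1 ?unitr1.
Qed.

Lemma unit_diag_trig_eq1 X :
  is_trig_mx X -> upper_trig_mx X -> (forall i, X i i = 1) -> X = 1%:M.
Proof.
move=> /is_trig_mxP lX /is_trig_mxP uX X1; apply/matrixP => i j; rewrite mxE.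
case: (ltngtP i j) => [ij|ji|/val_inj ->]; last by rewrite X1 eqxx.
  by rewrite lX //; case: eqP => // e; rewrite e ltnn in ij.
by have := uX _ _ ji; rewrite mxE => ->; case: eqP => // e; rewrite e ltnn in ji.
Qed.

Lemma commute_diag_mx (d : 'I_n -> R) X : injective d ->
  X *m diag_mx (\row_i d i) = diag_mx (\row_i d i) *m X ->
  forall i j, i != j -> X i j = 0.
Proof.
move=> injd /matrixP cX i j ij; have := cX i j.
rewrite mul_mx_diag mul_diag_mx !mxE => /eqP.
rewrite mulrC -subr_eq0 -mulrBl mulf_eq0 subr_eq0 => /orP[/eqP/injd e|/eqP //].
by rewrite e eqxx in ij.
Qed.

End BandMatrices.

(** * Uniqueness of the LU and QR factorizations *)

Section Factorizations.
Context {R : realType} {n : nat}.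
Implicit Types A L M P Q U X : 'M[R]_n.

Lemma lower_unitrigM L1 L2 : lower_unitrig_mx L1 -> lower_unitrig_mx L2 ->
  lower_unitrig_mx (L1 *m L2).
Proof.
move=> [+ d1] [+ d2]; rewrite !is_trig_mxT => t1 t2; split.
  by rewrite is_trig_mxT trmx_mul; exact: upper_trigM.
move=> i; rewrite -[_ *m _]trmxK mxE trmx_mul upper_trig_diagM //.
by rewrite !mxE d1 d2 mulr1.
Qed.

Lemma lower_unitrig_unitmx L : lower_unitrig_mx L -> L \in unitmx.
Proof. by case; exact: lower_unitrig_unit. Qed.

Lemma lower_unitrigV L : lower_unitrig_mx L -> lower_unitrig_mx (invmx L).
Proof.
move=> uL; have [tL dL] := uL.
have [||tI dI] := @upper_trigV _ _ L^T; first by rewrite /upper_trig_mx trmxK.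
  by move=> i; rewrite mxE dL oner_neq0.
rewrite -trmx_inv in tI dI; split; first by rewrite /upper_trig_mx trmxK in tI.
by move=> i; have := dI i; rewrite !mxE dL invr1.
Qed.

(** The quotient [L2^-1 L1 = U2 U1^-1] is both unit lower triangular and upper
    triangular.  The pivots of the second factorization are arbitrary because
    [LU_L] chooses among all factorizations of [M]. *)
Lemma LU_uniq M L1 U1 L2 U2 : is_LU M L1 U1 -> (forall i, U1 i i != 0) ->
  is_LU M L2 U2 -> L1 = L2 /\ U1 = U2.
Proof.
move=> [l1 u1 M1] nz1 [l2 u2 M2].
have unU := upper_trig_unit u1 nz1.
have unL := lower_unitrig_unitmx l2.
pose X := invmx L2 *m L1.
have XE : X = U2 *m invmx U1.
  apply: (can_inj (mulmxK unU)); rewrite mulmxKV // -mulmxA -M1 M2 mulKmx //.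
have [lX X1] : lower_unitrig_mx X := lower_unitrigM (lower_unitrigV l2) l1.
have uX : upper_trig_mx X.
  by rewrite XE; apply: upper_trigM => //; have [] := upper_trigV u1 nz1.
have {uX lX X1} X1 := unit_diag_trig_eq1 lX uX X1.
split; first by rewrite -[LHS]mul1mx -(mulmxV unL) -mulmxA -/X X1 mulmx1.
by rewrite -[RHS](mulmxKV unU) -XE X1 mul1mx.
Qed.

Lemma LU_LP M L U : is_LU M L U -> (forall i, U i i != 0) -> LU_L M = L.
Proof.
move=> MLU nz; rewrite /LU_L; apply: get_unique; first by exists U.
by move=> L' [U' MLU']; have [] := LU_uniq MLU nz MLU'.
Qed.

Lemma orthogonal_mulmxT Q : orthogonal_mx Q -> Q *m Q^T = 1%:M.
Proof. exact: mulmx1C. Qed.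

Lemma orthogonal_unit Q : orthogonal_mx Q -> Q \in unitmx.
Proof. by move=> /mulmx1_unit[]. Qed.

(** The quotient [X = Q2^T Q1 = U2 U1^-1] is upper triangular, and so is its
    inverse [X^T]; being orthogonal with positive diagonal, it is the identity. *)
Lemma QR_uniq M Q1 U1 Q2 U2 : is_QR M Q1 U1 -> is_QR M Q2 U2 -> Q1 = Q2.
Proof.
move=> [ ort1 u1 p1 M1] [ ort2 u2 p2 M2].
have nz1 i : U1 i i != 0 by rewrite gt_eqF.
have unU := upper_trig_unit u1 nz1; have [uV dV] := upper_trigV u1 nz1.
pose X := U2 *m invmx U1.
have QX : Q1 = Q2 *m X by rewrite /X mulmxA -M2 M1 mulmxK.
have uX : upper_trig_mx X by exact: upper_trigM.
have pX i : 0 < X i i by rewrite upper_trig_diagM // dV divr_gt0.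
clearbody X.
have oX : X^T *m X = 1%:M.
  by rewrite -ort1 QX trmx_mul mulmxA -(mulmxA X^T) ort2 mulmx1.
have lX : is_trig_mx X.
  have nzX i : X i i != 0 by rewrite gt_eqF.
  have [+ _] := upper_trigV uX nzX.
  have -> : invmx X = X^T.
    by rewrite -[LHS]mul1mx -oX mulmxK // upper_trig_unit.
  by rewrite /upper_trig_mx trmxK.
suff X1 : X = 1%:M by rewrite QX X1 mulmx1.
apply: unit_diag_trig_eq1 => // i.
have := upper_trig_diagM i (A := X^T) (B := X); rewrite oX !mxE eqxx.
rewrite {1}/upper_trig_mx trmxK => /(_ lX uX) /esym /eqP.
by rewrite -expr2 sqrf_eq1 => /orP[/eqP //|/eqP e]; have := pX i; rewrite e ltr0N1.
Qed.

Lemma QR_QP M Q U : is_QR M Q U -> QR_Q M = Q.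
Proof.
move=> h; rewrite /QR_Q; apply: get_unique; first by exists U.
by move=> Q' [U' h']; exact: QR_uniq h' h.
Qed.

End Factorizations.

(** * Cholesky and QR factorizations depending smoothly on a parameter *)

Section Cholesky.
Context {R : realType}.

Definition posdef n (G : 'M[R]_n) :=
  G^T = G /\ forall x : 'rV[R]_n, x != 0 -> 0 < (x *m G *m x^T) 0 0.

Lemma posdef_gram n (A : 'M[R]_n) : A \in unitmx -> posdef (A^T *m A).
Proof.
move=> uA; split; first by rewrite trmx_mul trmxK.
move=> x x0; set y := x *m A^T.
have y0 : y != 0.
  apply: contra x0 => /eqP yE; rewrite -[x](mulmxK (_ : A^T \in unitmx)).
    by rewrite -/y yE mul0mx.
  by rewrite unitmx_tr.
have -> : x *m (A^T *m A) *m x^T = y *m y^T.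
  by rewrite /y trmx_mul trmxK !mulmxA.
clearbody y; rewrite mxE lt_def sumr_ge0 ?andbT => [|i _]; last first.
  by rewrite mxE -expr2 sqr_ge0.
apply: contra y0; rewrite psumr_eq0 => [|i _]; last by rewrite mxE -expr2 sqr_ge0.
move=> /allP h; apply/eqP/rowP => i; have := h i (mem_index_enum i).
by rewrite !mxE mulf_eq0 orbb => /eqP.
Qed.

Definition schur_compl n (G : 'M[R]_(1 + n)) : 'M[R]_n :=
  drsubmx G - (G 0 0)^-1 *: ((ursubmx G)^T *m ursubmx G).

Lemma posdef_diag n (G : 'M[R]_n) i : posdef G -> 0 < G i i.
Proof.
move=> [_ /(_ (delta_mx 0 i))]; rewrite -rowE trmx_delta -colE !mxE.
by apply; apply/eqP => /matrixP/(_ 0 i)/eqP; rewrite !mxE !eqxx oner_eq0.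
Qed.

Lemma posdef_block n (G : 'M[R]_(1 + n)) : posdef G ->
  G = block_mx (G 0 0)%:M (ursubmx G) (ursubmx G)^T (drsubmx G).
Proof.
move=> [sG _]; rewrite -{1}[G]submxK; congr block_mx.
  rewrite [LHS]mx11_scalar !mxE; congr (G _ _)%:M; exact: val_inj.
by rewrite trmx_ursub sG.
Qed.

(** The form of the Schur complement at [y] is that of [G] at the vector obtained
    by completing [y] with the first coordinate that minimizes the latter. *)
Lemma posdef_schur n (G : 'M[R]_(1 + n)) : posdef G -> posdef (schur_compl G).
Proof.
move=> pG; have a0 := posdef_diag 0 pG; have GE := posdef_block pG.
have [sG dG] := pG; split.
  rewrite /schur_compl linearB /= linearZ /= trmx_mul trmxK.
  by rewrite trmx_drsub sG.
move=> y y0; move: GE a0; rewrite /schur_compl.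
set a := G 0 0; set r := ursubmx G; set N := drsubmx G => GE a0.
(* The first coordinate makes the first entry of [x *m G] vanish. *)
pose x : 'rV[R]_(1 + n) := row_mx (- a^-1 *: (y *m r^T)) y.
have x0 : x != 0.
  apply: contra y0 => /eqP xE; have := row_mxKr (- a^-1 *: (y *m r^T)) y.
  by rewrite -/x xE linear0 => <-.
have := dG x x0.
suff -> : x *m G *m x^T = y *m (N - a^-1 *: (r^T *m r)) *m y^T by [].
rewrite GE /x mul_row_block tr_row_mx mul_row_col.
rewrite mul_mx_scalar scalerA mulrN mulfV ?gt_eqF // scaleN1r addNr mul0mx add0r.
congr (_ *m _); rewrite mulmxBr addrC -scalemxAl scaleNr.
by rewrite -scalemxAr mulmxA.
Qed.

Context {V : normedModType R} (D : set V).

Lemma smooth_block_mx m1 m2 n1 n2 (A : V -> 'M[R]_(m1, n1))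
    (B : V -> 'M[R]_(m1, n2)) (C : V -> 'M[R]_(m2, n1)) (E : V -> 'M[R]_(m2, n2)) :
  smooth_entries D A -> smooth_entries D B -> smooth_entries D C ->
  smooth_entries D E ->
  smooth_entries D (fun x => block_mx (A x) (B x) (C x) (E x)).
Proof.
move=> sA sB sC sE i j; rewrite -(fintype.splitK i) -(fintype.splitK j).
case: (fintype.split i) (fintype.split j) => i' [] j' /=.
- by under eq_fun do rewrite block_mxEul; exact: sA.
- by under eq_fun do rewrite block_mxEur; exact: sB.
- by under eq_fun do rewrite block_mxEdl; exact: sC.
- by under eq_fun do rewrite block_mxEdr; exact: sE.
Qed.

Hypothesis oD : open D.

(** Eliminating the first variable: the first row of the factor is that of [G]
    divided by the square root of the pivot, and the rest is the factor of the
    Schur complement.  Each step preserves smoothness because the pivot is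
    positive. *)
Lemma smooth_cholesky n (G : V -> 'M[R]_n) :
  (forall x, D x -> posdef (G x)) -> smooth_entries D G ->
  exists2 C : V -> 'M[R]_n, smooth_entries D C &
    forall x, D x -> [/\ upper_trig_mx (C x), forall i, 0 < C x i i
      & (C x)^T *m C x = G x].
Proof.
elim: n G => [|n IH] G pG sG.
  exists G => // x Dx; split=> [|[]//|]; last by apply/matrixP => -[].
  by apply/is_trig_mxP => -[].
pose a x := G x 0 0; pose r x : 'rV[R]_n := ursubmx (G x : 'M[R]_(1 + n)).
have a0 x : D x -> 0 < a x by move=> /pG; exact: posdef_diag.
have an0 x : D x -> a x != 0 by move=> /a0; rewrite lt0r => /andP[].
have sa : smooth_on_open D a by exact: sG.
have sr : smooth_entries D r.
  by move=> i j; rewrite /r; under eq_fun do rewrite !mxE; exact: sG.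
pose S x := schur_compl (G x : 'M[R]_(1 + n)).
have sS : smooth_entries D S.
  have -> : S = fun x => drsubmx (G x : 'M[R]_(1 + n)) +
      (-1 * (a x)^-1) *: ((r x)^T *m r x).
    by apply/funext => x; rewrite mulN1r scaleNr.
  apply: smooth_addmx => //.
    by move=> i j; under eq_fun do rewrite !mxE; exact: sG.
  apply: smooth_scalemx => //.
    by apply: smoothM => //; [exact: smooth_cst|exact: smoothV].
  by apply: smooth_mulmx => //; exact: smooth_trmx.
have pS x : D x -> posdef (S x) by move=> /pG; exact: posdef_schur.
have [C' sC' hC'] := IH S pS sS.
pose s x := Num.sqrt (a x).
have s0 x : D x -> 0 < s x by move=> /a0; rewrite sqrtr_gt0.
have ss : smooth_on_open D s by exact: smooth_sqrt.
exists (fun x => block_mx (s x)%:M ((s x)^-1 *: r x) 0 (C' x) : 'M[R]_(1 + n)).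
  apply: (@smooth_block_mx 1 n 1 n) => //.
  - by move=> i j; under eq_fun do rewrite mxE !ord1 eqxx mulr1n; exact: ss.
  - apply: smooth_scalemx => //; apply: smoothV => // x Dx.
    by rewrite gt_eqF ?s0.
  - exact: smooth_cst_mx.
move=> x Dx; have [uC dC CE] := hC' x Dx; split.
- rewrite /upper_trig_mx (@tr_block_mx _ 1 n 1 n) (@is_trig_block_mx _ 1 n 1 n) //.
  by rewrite trmx0 eqxx tr_scalar_mx scalar_mx_is_trig.
- move=> i; rewrite -(@fintype.splitK 1 n i); case: (@fintype.split 1 n i) => j /=.
    by rewrite (@block_mxEul _ 1 n 1 n) !mxE ord1 eqxx s0.
  by rewrite (@block_mxEdr _ 1 n 1 n).
- rewrite (@tr_block_mx _ 1 n 1 n) (@mulmx_block _ 1 n 1 n 1 n).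
  rewrite [RHS](@posdef_block n); last exact: pG.
  rewrite trmx0 tr_scalar_mx !mul0mx !mulmx0 !addr0 CE.
  have ssE : s x * s x = a x by rewrite -expr2 sqr_sqrtr // ltW // a0.
  have sn0 : s x != 0 by rewrite gt_eqF ?s0.
  have eq_block (A1 A2 : 'M[R]_1) (B1 B2 : 'M[R]_(1, n)) (C1 C2 : 'M[R]_(n, 1))
      (E1 E2 : 'M[R]_n) : A1 = A2 -> B1 = B2 -> C1 = C2 -> E1 = E2 ->
    block_mx A1 B1 C1 E1 = block_mx A2 B2 C2 E2 by move=> -> -> -> ->.
  apply: eq_block.
  + by rewrite -scalar_mxM ssE.
  + by rewrite mul_scalar_mx scalerA mulfV // scale1r.
  + by rewrite mul_mx_scalar linearZ /= scalerA mulfV // scale1r.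
  + rewrite /S /schur_compl -scalemxAr linearZ /= -scalemxAl scalerA -invfM ssE.
    by rewrite addrC subrK.
Qed.

End Cholesky.

(** If [C^T C = M^T M] then [M C^-1] is orthogonal: the triangular factor of [M] is
    the Cholesky factor of its Gram matrix. *)
Lemma smooth_QR (R : realType) (V : normedModType R) (D : set V) n
    (M : V -> 'M[R]_n) :
  open D -> (forall x, D x -> M x \in unitmx) -> smooth_entries D M ->
  exists2 C : V -> 'M[R]_n, smooth_entries D C &
    forall x, D x -> is_QR (M x) (M x *m invmx (C x)) (C x).
Proof.
move=> oD uM sM.
have pG x : D x -> posdef ((M x)^T *m M x) by move=> /uM; exact: posdef_gram.
have sG : smooth_entries D (fun x => (M x)^T *m M x).
  by apply: smooth_mulmx => //; exact: smooth_trmx.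
have [C sC hC] := smooth_cholesky oD pG sG.
exists C => // x Dx; have [uC pC CE] := hC x Dx.
have unC : C x \in unitmx by apply: upper_trig_unit => // i; rewrite gt_eqF.
split=> //; last by rewrite mulmxKV.
rewrite /orthogonal_mx trmx_mul mulmxA -(mulmxA _ (M x)^T) -CE.
by rewrite !mulmxA -trmx_mul mulmxV // trmx1 mul1mx mulmxV.
Qed.

(** * Bidiagonal coordinates and normalized diagonalizations *)

Section Charts.
Context {R : realType} {m : nat}.
Variables (lam : 'I_m.+1 -> R) (p : {perm 'I_m.+1}).
Hypothesis lam_inj : injective lam.

Local Notation d i := (lam (p i)).
Local Notation D := (Lambda_perm lam p).
Local Notation bidiag := (bidiagonal lam p).

Lemma d_inj : injective (fun i => d i).
Proof. by move=> i j /lam_inj /perm_inj. Qed.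

Lemma d_sub_neq0 i j : i != j -> d i - d j != 0.
Proof. by move=> ij; rewrite subr_eq0; apply: contra ij => /eqP/d_inj ->. Qed.

Lemma val_sub_row (k : 'I_m) : sub_row k = k.+1 :> nat.
Proof. by rewrite /sub_row lift0. Qed.

Lemma val_sub_col (k : 'I_m) : sub_col k = k :> nat.
Proof. by []. Qed.

Lemma ord_eqE n (i j : 'I_n) : (i == j) = (i == j :> nat).
Proof. by []. Qed.

Lemma sub_row_neq_col (k : 'I_m) : (sub_row k == sub_col k) = false.
Proof. by rewrite ord_eqE val_sub_row val_sub_col gtn_eqF. Qed.

Lemma bidiagonalE b i j : bidiag b i j = d i *+ (i == j) +
  \sum_k b 0 k * ((i == sub_row k) && (j == sub_col k))%:R.
Proof.
rewrite /bidiagonal /Lambda_perm mxE summxE !mxE; congr (_ + _).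
by apply: eq_bigr => k _; rewrite !mxE.
Qed.

Lemma bidiagonal_sub b k : bidiag b (sub_row k) (sub_col k) = b 0 k.
Proof.
rewrite bidiagonalE (bigD1 k) //= !eqxx mulr1 big1 ?addr0 => [|l l_k].
  by rewrite sub_row_neq_col add0r.
by rewrite (inj_eq lift_inj) eq_sym (negbTE l_k) mulr0.
Qed.

Lemma bidiagonal_diag b i : bidiag b i i = d i.
Proof.
rewrite bidiagonalE eqxx mulr1n big1 ?addr0 // => k _.
case: andP => [[/eqP -> /eqP/eqP]|_]; last by rewrite mulr0.
by rewrite sub_row_neq_col.
Qed.

Lemma bidiagonal_out b (i j : 'I_m.+1) : (i : nat) != j -> (i : nat) != j.+1 ->
  bidiag b i j = 0.
Proof.
move=> ij ij1; rewrite bidiagonalE ord_eqE (negbTE ij) add0r big1 // => k _.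
case: andP => [[/eqP iE /eqP jE]|_]; last by rewrite mulr0.
by rewrite iE jE val_sub_row val_sub_col eqxx in ij1.
Qed.

Lemma bidiagonal_hess b : lower_bandwidth 1 (bidiag b).
Proof. by move=> i j ij; rewrite bidiagonal_out //; lia. Qed.

Lemma eq_bidiagonal A : is_trig_mx A -> lower_bandwidth 1 A ->
  (forall i, A i i = d i) -> A = bidiag (\row_k A (sub_row k) (sub_col k)).
Proof.
move=> /is_trig_mxP tA hA dA; apply/matrixP => i j.
case: (ltngtP i j) => [ij|ji|/val_inj ->]; last by rewrite bidiagonal_diag.
  by rewrite tA // bidiagonal_out //; lia.
have [ij1|ij1] := eqVneq (i : nat) j.+1; last first.
  by rewrite hA ?bidiagonal_out //; lia.
have jm : (j < m)%N by have := ltn_ord i; lia.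
have -> : j = sub_col (Ordinal jm) by exact: val_inj.
have -> : i = sub_row (Ordinal jm) by apply: ord_inj; rewrite val_sub_row ij1.
by rewrite bidiagonal_sub mxE.
Qed.

(** The entry (i, j) of [L B = D L] reads
    [L_(i,j+1) b_j = (d_i - d_j) L_(i,j)], which determines each row of [L] from
    the diagonal leftwards. *)
Definition eigen_L (b : 'rV[R]_m) : 'M[R]_m.+1 := \matrix_(i, j)
  if (j <= i)%N then \prod_(k < m | (j <= k < i)%N) (b 0 k / (d i - d (sub_col k)))
  else 0.

Lemma eigen_L_unitrig b : lower_unitrig_mx (eigen_L b).
Proof.
split; first by apply/is_trig_mxP => i j ij; rewrite mxE leqNgt ij.
move=> i; rewrite mxE leqnn big_pred0 // => k.
by apply/negP => /andP[ik ki]; have := leq_ltn_trans ik ki; rewrite ltnn.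
Qed.

Lemma eigen_LE b : eigen_L b *m bidiag b = D *m eigen_L b.
Proof.
have [/is_trig_mxP tL dL] := eigen_L_unitrig b.
apply/matrixP => i j.
have -> : (D *m eigen_L b) i j = d i * eigen_L b i j.
  by rewrite mul_diag_mx mxE [in LHS]mxE.
rewrite mxE (bigD1 j) //= bidiagonal_diag.
(* The last column of [B] has no subdiagonal entry. *)
have [jm|mj] := ltnP j m; last first.
  rewrite big1 ?addr0 => [|l lj].
    have [ij|ij] := ltnP i j; first by rewrite tL // mulr0 mul0r.
    have -> : i = j by apply: val_inj => /=; have := ltn_ord i; lia.
    by rewrite mulrC.
  rewrite bidiagonal_out ?mulr0 //.
  by have := ltn_ord l; lia.
pose k := Ordinal jm; have jE : j = sub_col k by exact: val_inj.
have kE : k = j :> nat by [].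
rewrite (bigD1 (sub_row k)) /=; last first.
  by rewrite ord_eqE val_sub_row /=; lia.
rewrite big1 ?addr0 => [|l /andP[lj lk]]; last first.
  by rewrite bidiagonal_out ?mulr0.
have -> : bidiag b (sub_row k) j = b 0 k by rewrite -bidiagonal_sub -jE.
case: (ltngtP i j) => [ij|ji|/val_inj ij]; last 1 first.
- by rewrite -ij dL [eigen_L b i _]tL ?mul0r ?mul1r ?mulr1 ?addr0 // val_sub_row ij.
- by rewrite !tL ?mul0r ?mulr0 ?addr0 // val_sub_row; apply: ltn_trans ij _.
have -> : eigen_L b i j = b 0 k / (d i - d j) * eigen_L b i (sub_row k).
  rewrite !mxE (ltnW ji) val_sub_row /= ji (bigD1 k) /=; last by rewrite leqnn ji.
  rewrite -jE; congr (_ * _); apply: eq_bigl => l; rewrite ord_eqE; lia.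
have ij : i != j by rewrite ord_eqE; lia.
by field; exact: d_sub_neq0.
Qed.

Lemma eigen_L_conj b : bidiag b = invmx (eigen_L b) *m D *m eigen_L b.
Proof.
by rewrite -mulmxA -eigen_LE mulKmx // lower_unitrig_unitmx //; exact: eigen_L_unitrig.
Qed.

(** [L2 L1^-1] commutes with [D], hence is diagonal, and it has unit diagonal. *)
Lemma conj_unitrig_inj L1 L2 : lower_unitrig_mx L1 -> lower_unitrig_mx L2 ->
  invmx L1 *m D *m L1 = invmx L2 *m D *m L2 -> L1 = L2.
Proof.
move=> l1 l2 E; have u1 := lower_unitrig_unitmx l1.
have u2 := lower_unitrig_unitmx l2.
have [_ X1] := lower_unitrigM l2 (lower_unitrigV l1).
have XC : (L2 *m invmx L1) *m D = D *m (L2 *m invmx L1).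
  apply: (can_inj (mulmxK u1)); rewrite -!mulmxA mulVmx // mulmx1.
  by rewrite (mulmxA (invmx L1)) E !mulmxA mulmxV // mul1mx.
suff XE : L2 *m invmx L1 = 1%:M by rewrite -[RHS](mulmxKV u1) XE mul1mx.
apply/matrixP => i j; rewrite !mxE.
have [<-|ij] := eqVneq i j; first by have := X1 i; rewrite mxE.
by have := commute_diag_mx d_inj XC ij; rewrite mxE.
Qed.

Lemma phi_L_unique L b : lower_unitrig_mx L ->
  bidiag b = invmx L *m D *m L -> phi_L lam p b = L.
Proof.
move=> uL bE; rewrite /phi_L; apply: get_unique => // L' [uL' bE'].
by apply: conj_unitrig_inj; rewrite // -bE -bE'.
Qed.

Lemma phi_LE b : phi_L lam p b = eigen_L b.
Proof. by apply: phi_L_unique; [exact: eigen_L_unitrig|exact: eigen_L_conj]. Qed.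

Lemma normalized_diagK T Q :
  orthogonal_mx Q -> T = Q^T *m D *m Q -> D = Q *m T *m Q^T.
Proof.
move=> /orthogonal_mulmxT oQ ->.
by rewrite !mulmxA oQ mul1mx -mulmxA oQ mulmx1.
Qed.

(** Two diagonalizations differ by an orthogonal matrix [X] commuting with [D],
    that is, by a diagonal matrix of signs.  Multiplying [Q1 = L1 U1] by [X] gives
    the LU factorization [(X L1 X) (X U1)], so that positivity of both diagonals
    forces all the signs to be 1. *)
Lemma normalized_diag_uniq T Q1 Q2 :
  normalized_diag lam p T Q1 -> normalized_diag lam p T Q2 -> Q1 = Q2.
Proof.
move=> [ ort1 [L1 [U1 [[l1 u1 QE1] p1]]] T1] [ ort2 [L2 [U2 [LU2 p2]]] T2].
have := normalized_diagK ort1 T1; have := normalized_diagK ort2 T2 => D2 D1.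
pose X := Q2 *m Q1^T.
have QX : Q2 = X *m Q1 by rewrite /X -mulmxA ort1 mulmx1.
have XC : X *m D = D *m X.
  have -> : X *m D = Q2 *m T *m Q1^T.
    by rewrite D1 /X !mulmxA -(mulmxA Q2) ort1 mulmx1.
  by rewrite D2 /X !mulmxA -(mulmxA _ Q2^T Q2) ort2 mulmx1.
have X0 i j : i != j -> X i j = 0 by exact: commute_diag_mx d_inj XC i j.
have XE : X = diag_mx (\row_i X i i).
  apply/matrixP => i j; rewrite [RHS]mxE [(\row__ _) _ _]mxE.
  by case: eqVneq => [->|/X0 ->]; rewrite ?mulr1n ?mulr0n.
have XA A i j : (X *m A) i j = X i i * A i j.
  by rewrite XE mul_diag_mx mxE [in LHS]mxE -XE.
have AX A i j : (A *m X) i j = A i j * X j j.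
  by rewrite XE mul_mx_diag mxE [in X in _ * X = _]mxE -XE.
clearbody X.
have XX : X *m X = 1%:M.
  rewrite -(orthogonal_mulmxT ort2) QX trmx_mul mulmxA -(mulmxA X).
  by rewrite (orthogonal_mulmxT ort1) mulmx1 [in X^T]XE tr_diag_mx -XE.
(* [X L1 X] is unit lower triangular because [X X = 1]. *)
have LUX : is_LU Q2 (X *m L1 *m X) (X *m U1).
  have [/is_trig_mxP tl dl] := l1.
  split.
  - split=> [|i].
      by apply/is_trig_mxP => i j ij; rewrite AX XA tl // mulr0 mul0r.
    by rewrite AX XA dl mulr1 -XA XX mxE eqxx.
  - apply/is_trig_mxP => i j ij; rewrite mxE XA.
    by have /is_trig_mxP/(_ _ _ ij) := u1; rewrite mxE => ->; rewrite mulr0.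
  - by rewrite QX QE1 !mulmxA -(mulmxA _ X X) XX mulmx1.
have nz2 i : U2 i i != 0 by rewrite gt_eqF.
have [_ UE] := LU_uniq LU2 nz2 LUX.
suff X1 : X = 1%:M by rewrite QX X1 mul1mx.
apply/matrixP => i j; rewrite mxE; have [<-|/X0 ->//] := eqVneq i j.
have /matrixP/(_ i i) := XX; rewrite XA mxE eqxx => /eqP.
rewrite -expr2 sqrf_eq1 => /orP[/eqP //|/eqP e].
by have := p2 i; rewrite UE XA e mulN1r oppr_gt0 ltNge ltW.
Qed.

(** This identity carries the correspondence: the left-hand side is
    lower triangular, the right-hand side has the bandwidth of [T]. *)
Lemma unitrig_conj_band Q L U : orthogonal_mx Q -> is_LU Q L U ->
  (forall i, U i i != 0) ->
  invmx L *m D *m L = U *m (Q^T *m D *m Q) *m invmx U.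
Proof.
move=> oQ [lL uU QE] nz; have unU := upper_trig_unit uU nz.
have unL := lower_unitrig_unitmx lL.
have LE : L = Q *m invmx U by rewrite QE mulmxK.
have -> : invmx L = U *m Q^T.
  apply: (can_inj (mulmxK unL)); rewrite mulVmx // {1}LE mulmxA -(mulmxA U) oQ.
  by rewrite mulmx1 mulmxV.
by rewrite {1}LE !mulmxA.
Qed.

(** The permutation of the eigenvalues is absorbed in the conjugating matrix. *)
Lemma conj_isospectral Q T : orthogonal_mx Q -> tridiagonal T ->
  T = Q^T *m D *m Q -> isospectral lam T.
Proof.
move=> oQ triT TE; split=> //.
  by rewrite TE !trmx_mul trmxK tr_diag_mx mulmxA.
have uQ := orthogonal_unit oQ.
have uP := unitmx_perm R p.
set S := perm_mx p in uP *.
pose P := invmx S *m Q.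
have uPQ : P \in unitmx by rewrite unitmx_mul unitmx_inv uP uQ.
have PV : invmx P = Q^T *m S.
  rewrite -[RHS](mulmxK uPQ) /P !mulmxA -(mulmxA _ S) mulmxV // mulmx1.
  by rewrite oQ mul1mx.
exists P => //.
have DE : D = S *m Lambda lam *m invmx S.
  apply: (can_inj (mulmxK uP)); rewrite mulmxKV //; apply/matrixP => i j.
  rewrite mul_diag_mx mul_mx_diag !mxE.
  by case: eqP => [->|]; rewrite ?mulr1 ?mul1r // mulr0 mul0r.
by rewrite TE DE PV /P !mulmxA.
Qed.

Lemma psi_QP T Q : normalized_diag lam p T Q -> psi_Q lam p T = Q.
Proof.
move=> nQ; rewrite /psi_Q; apply: get_unique => // Q' nQ'.
exact: normalized_diag_uniq nQ' nQ.
Qed.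

(** * The parametrization and its left inverse *)

Section PhiPoint.
Variables (b : 'rV[R]_m) (Q U : 'M[R]_m.+1).
Hypothesis QR : is_QR (eigen_L b) Q U.

Let nzU i : U i i != 0.
Proof. by have [_ _ + _] := QR => /(_ i); rewrite lt0r => /andP[]. Qed.

Lemma phi_QR : phi lam p b = Q^T *m D *m Q.
Proof. by rewrite /phi phi_LE (QR_QP QR). Qed.

(** A QR factorization [L = Q U] is the same thing as an LU factorization
    [Q = L U^-1]. *)
Lemma eigen_frame_LU :
  is_LU Q (eigen_L b) (invmx U) /\ forall i, 0 < invmx U i i.
Proof.
have [oQ uU pU LE] := QR; have [uV dV] := upper_trigV uU nzU.
split=> [|i]; last by rewrite dV invr_gt0.
split=> //; first exact: eigen_L_unitrig.
by rewrite LE mulmxK // upper_trig_unit.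
Qed.

Lemma phi_normalized : normalized_diag lam p (phi lam p b) Q.
Proof.
have [oQ uU pU LE] := QR; split=> //; last exact: phi_QR.
by exists (eigen_L b), (invmx U); exact: eigen_frame_LU.
Qed.

Lemma phi_in_chart : chart_domain lam p (phi lam p b).
Proof.
have [oQ uU pU LE] := QR; have [uV dV] := upper_trigV uU nzU.
split; last by exists Q; exact: phi_normalized.
have unU := upper_trig_unit uU nzU.
have [LU pV] := eigen_frame_LU.
have TE : phi lam p b = U *m bidiag b *m invmx U.
  rewrite eigen_L_conj (unitrig_conj_band oQ LU); last by move=> i; rewrite gt_eqF.
  by rewrite invmxK !mulmxA mulmxV // mul1mx -mulmxA mulmxV // mulmx1 phi_QR.
have hT : lower_bandwidth 1 (phi lam p b).
  rewrite TE; move/upper_trig_band in uU; move/upper_trig_band in uV.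
  exact: lower_bandwidthM (lower_bandwidthM uU (@bidiagonal_hess b)) uV.
have sT : (phi lam p b)^T = phi lam p b.
  by rewrite phi_QR !trmx_mul trmxK tr_diag_mx mulmxA.
apply: conj_isospectral oQ _ phi_QR => i j /orP[ij|ji]; last by rewrite hT //; lia.
by rewrite -sT mxE hT //; lia.
Qed.

Lemma psi_phi : psi lam p (phi lam p b) = b.
Proof.
have [LU pV] := eigen_frame_LU.
rewrite /psi (psi_QP phi_normalized) (LU_LP LU) => [|i]; last by rewrite gt_eqF.
by apply/rowP => k; rewrite -eigen_L_conj mxE bidiagonal_sub.
Qed.

End PhiPoint.

(** * Coordinates of a matrix of the chart domain *)

Section PsiPoint.
Variables (T Q L U : 'M[R]_m.+1).
Hypotheses (triT : tridiagonal T) (oQ : orthogonal_mx Q)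
  (TE : T = Q^T *m D *m Q) (QLU : is_LU Q L U) (pU : forall i, 0 < U i i).

Let nzU i : U i i != 0. Proof. by rewrite gt_eqF. Qed.
Let uU : upper_trig_mx U. Proof. by have [] := QLU. Qed.
Let uV : upper_trig_mx (invmx U). Proof. by have [] := upper_trigV uU nzU. Qed.
Let hT : lower_bandwidth 1 T.
Proof. by move=> i j ij; apply: triT; apply/orP; right; lia. Qed.

Lemma psi_frameE k :
  psi lam p T 0 k = (invmx L *m D *m L) (sub_row k) (sub_col k).
Proof.
have nT : normalized_diag lam p T Q by split=> //; exists L, U.
by rewrite /psi mxE (psi_QP nT) (LU_LP QLU nzU).
Qed.

(** Conjugation by a triangular matrix only rescales the extreme subdiagonal, so
    that ratios of pivots of [Q] are all that [psi] requires besides [T]. *)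
Lemma psi_corner k :
  psi lam p T 0 k =
    T (sub_row k) (sub_col k) * (U (sub_row k) (sub_row k) / U (sub_col k) (sub_col k)).
Proof.
rewrite psi_frameE (unitrig_conj_band oQ QLU nzU) -TE.
have bU := (upper_trig_band _).1 uU; have bV := (upper_trig_band _).1 uV.
have bUT := lower_bandwidthM bU hT.
rewrite (band_corner_mulmx bUT bV (l := sub_col k)) ?addn0 //; last first.
  by rewrite val_sub_row val_sub_col; lia.
rewrite (band_corner_mulmx bU hT (l := sub_row k)) ?addn0 //; last first.
  by rewrite val_sub_row val_sub_col; lia.
have [_ ->] := upper_trigV uU nzU.
by rewrite mulrCA mulrA.
Qed.

Lemma bidiagonal_psi : invmx L *m D *m L = bidiag (psi lam p T).
Proof.
have [lL _ _] := QLU.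
have psiE : psi lam p T = \row_k (invmx L *m D *m L) (sub_row k) (sub_col k).
  by apply/rowP => k; rewrite psi_frameE [RHS]mxE.
have [tV dV] := lower_unitrigV lL; have [tL dL] := lL.
have uD : upper_trig_mx D^T by rewrite -is_trig_mxT diag_mx_is_trig.
rewrite !is_trig_mxT in tV tL.
rewrite psiE; apply: eq_bidiagonal.
- by rewrite is_trig_mxT !trmx_mul; apply: upper_trigM => //; exact: upper_trigM.
- rewrite (unitrig_conj_band oQ QLU nzU) -TE.
  have bU := (upper_trig_band _).1 uU; have bV := (upper_trig_band _).1 uV.
  exact: lower_bandwidthM (lower_bandwidthM bU hT) bV.
- move=> i; rewrite -[_ *m L]trmxK mxE !trmx_mul !upper_trig_diagM //.
    by rewrite !mxE dV dL eqxx mulr1n mul1r mulr1.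
  exact: upper_trigM.
Qed.

Lemma phi_psi : phi lam p (psi lam p T) = T.
Proof.
have [lL _ QE] := QLU; have [_ dV] := upper_trigV uU nzU.
have QR : is_QR L Q (invmx U).
  split=> // [i|]; first by rewrite dV invr_gt0.
  by rewrite QE mulmxK // upper_trig_unit.
have LE := phi_L_unique lL (esym bidiagonal_psi).
by rewrite /phi LE (QR_QP QR) -TE.
Qed.

End PsiPoint.

(** * Leading minors of the diagonalizing matrix *)

Section LeadingMinors.

Definition coord_proj k : 'M[R]_m.+1 := diag_mx (\row_i (i < k)%N%:R).

(** The leading block of size [k], completed by the identity, so that leading
    minors become determinants of matrices of one fixed size. *)
Definition corner k (A : 'M[R]_m.+1) : 'M[R]_m.+1 :=
  coord_proj k *m A *m coord_proj k + (1%:M - coord_proj k).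

Lemma cornerE k A i j : corner k A i j =
  if (i < k)%N && (j < k)%N then A i j else (i == j)%:R.
Proof.
rewrite /corner mxE mul_mx_diag mxE mul_diag_mx !mxE.
case: (ltnP i k) => ik; case: (ltnP j k) => jk /=;
  rewrite ?mul1r ?mulr1 ?mul0r ?mulr0 ?add0r ?subr0 ?mul0rn ?subr0 //.
- by case: eqP => _; rewrite ?subrr ?addr0 // mulr0n subr0 addr0.
- by case: eqP => [ij|_]; rewrite ?mulr0n ?subr0 //; rewrite ij ltnNge jk in ik.
Qed.

Lemma cornerM k A B :
  corner k A *m corner k B = corner k (A *m coord_proj k *m B).
Proof.
have PP : coord_proj k *m coord_proj k = coord_proj k.
  apply/matrixP => i j; rewrite mul_diag_mx !mxE.
  by case: (i < k)%N; rewrite ?mul1r // mul0r mul0rn.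
rewrite /corner; set P := coord_proj k in PP *; set E := 1%:M - P.
have PE : P *m E = 0 by rewrite mulmxBr mulmx1 PP subrr.
have EP : E *m P = 0 by rewrite mulmxBl mul1mx PP subrr.
have EE : E *m E = E by rewrite {1}/E mulmxBl mul1mx PE subr0.
clearbody E; rewrite mulmxDl !mulmxDr EE -[_ *m P *m E]mulmxA PE mulmx0 addr0.
by rewrite [E *m _]mulmxA [E *m (_ *m _)]mulmxA EP !mul0mx add0r !mulmxA
  -[_ *m P *m P]mulmxA PP.
Qed.

(** Triangularity of [L] makes the leading block of [L U] the product of the
    leading blocks. *)
Lemma det_corner_LU k Q L U : is_LU Q L U ->
  \det (corner k Q) = \prod_(i < m.+1 | (i < k)%N) U i i.
Proof.
move=> [[/is_trig_mxP tL dL] /is_trig_mxP uU QE].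
have -> : corner k Q = corner k L *m corner k U.
  rewrite cornerM QE; apply/matrixP => i j; rewrite !cornerE.
  case: ifP => // /andP[ik jk]; rewrite mul_mx_diag !mxE.
  apply: eq_bigr => l _; rewrite !mxE.
  have [lk|kl] := ltnP l k; first by rewrite mulr1.
  by rewrite tL ?mul0r // (leq_trans ik).
rewrite det_mulmx det_trig; last first.
  apply/is_trig_mxP => i j ij; rewrite cornerE tL // ord_eqE ltn_eqF //.
  by case: ifP.
rewrite big1 ?mul1r => [|i _]; last by rewrite cornerE dL eqxx; case: ifP.
rewrite -det_tr det_trig; last first.
  apply/is_trig_mxP => i j ij; rewrite mxE cornerE.
  have -> : U j i = 0 by have := uU _ _ ij; rewrite mxE.
  by rewrite ord_eqE gtn_eqF //; case: ifP.
rewrite [RHS]big_mkcond /=; apply: eq_bigr => i _.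
by rewrite mxE cornerE eqxx andbb.
Qed.

(** Lagrange interpolation, at the permuted eigenvalues, of the indicator of the
    first [k] of them: at [T] it gives the orthogonal projection on the span
    of their eigenvectors. *)
Definition indicator_poly k : {poly R} := \sum_(i < m.+1 | (i < k)%N)
  \prod_(j < m.+1 | j != i) ((d i - d j)^-1 *: ('X - (d j)%:P)).

Lemma indicator_polyE k i : (indicator_poly k).[d i] = (i < k)%N%:R.
Proof.
have term j : (\prod_(l < m.+1 | l != j) ((d j - d l)^-1 *: ('X - (d l)%:P))).[d i]
    = (i == j)%:R.
  rewrite horner_prod; have [->|ij] := eqVneq i j.
    by apply: big1 => l lj; rewrite !hornerE mulVf // d_sub_neq0 // eq_sym.
  by rewrite (bigD1 i) //= !hornerE subrr mulr0 mul0r.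
rewrite /indicator_poly horner_sum; under eq_bigr do rewrite term.
have [ik|ki] := ltnP i k.
  rewrite (bigD1 i) //= eqxx big1 ?addr0 // => l /andP[_ li].
  by rewrite eq_sym (negbTE li).
by apply: big1 => l lk; case: eqP => // il; rewrite il leqNgt lk in ki.
Qed.

Definition gram_minor k (T : 'M[R]_m.+1) :=
  \det (corner k (horner_mx T (indicator_poly k))).

(** The leading block of [Q^T P_k Q], with [P_k] the coordinate projection, is the
    Gram matrix of the leading block of [Q]. *)
Lemma gram_minorE k T Q L U : orthogonal_mx Q -> T = Q^T *m D *m Q ->
  is_LU Q L U ->
  gram_minor k T = (\prod_(i < m.+1 | (i < k)%N) U i i) ^+ 2.
Proof.
move=> oQ TE QLU; rewrite -(det_corner_LU k QLU) /gram_minor.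
have QV : Q^T = invmx Q.
  have uQ := orthogonal_unit oQ.
  by rewrite -[LHS]mulmx1 -(mulmxV uQ) mulmxA oQ mul1mx.
have -> : horner_mx T (indicator_poly k) = Q^T *m coord_proj k *m Q.
  rewrite TE QV horner_mx_uconjC; last exact: orthogonal_unit.
  rewrite horner_mx_diag; congr (_ *m diag_mx _ *m _).
  by apply/rowP => i; rewrite !mxE indicator_polyE.
have cT A : corner k A^T = (corner k A)^T.
  by apply/matrixP => i j; rewrite [RHS]mxE !cornerE mxE andbC eq_sym.
by rewrite -cornerM det_mulmx cT det_tr expr2.
Qed.

End LeadingMinors.

End Charts.

(** * Smoothness of the two maps *)

Section SmoothCharts.
Context {R : realType} {m : nat}.
Variables (lam : 'I_m.+1 -> R) (p : {perm 'I_m.+1}).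
Hypothesis lam_inj : injective lam.

Local Notation D := (Lambda_perm lam p).

Lemma smooth_horner_mx (V : normedModType R) (U : set V) n
    (A : V -> 'M[R]_n.+1) (q : {poly R}) :
  open U -> smooth_entries U A -> smooth_entries U (fun x => horner_mx (A x) q).
Proof.
move=> oU sA; elim/poly_ind: q => [|q c IH].
  by under eq_fun do rewrite rmorph0; exact: smooth_cst_mx.
have -> : (fun x => horner_mx (A x) (q * 'X + c%:P)) =
          (fun x => horner_mx (A x) q *m A x + c%:M).
  by apply/funext => x; rewrite rmorphD rmorphM /= horner_mx_X horner_mx_C.
apply: smooth_addmx => //; last exact: smooth_cst_mx.
exact: smooth_mulmx.
Qed.

Lemma smooth_eigen_L : smooth_entries setT (eigen_L lam p).
Proof.
move=> i j; under eq_fun do rewrite mxE.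
case: (j <= i)%N; last exact: smooth_cst.
apply: smooth_prod => [|k _]; first exact: openT.
by apply: smoothM; [exact: openT|exact: smooth_coord|exact: smooth_cst].
Qed.

Lemma eigen_L_frame : exists2 C : 'rV[R]_m -> 'M[R]_m.+1,
  smooth_entries setT C &
  forall b, is_QR (eigen_L lam p b) (eigen_L lam p b *m invmx (C b)) (C b).
Proof.
have uL b : [set: 'rV[R]_m] b -> eigen_L lam p b \in unitmx.
  by move=> _; exact/lower_unitrig_unitmx/eigen_L_unitrig.
have [C sC hC] := smooth_QR openT uL smooth_eigen_L.
by exists C => // b; exact: hC.
Qed.

(** Everything in [phi b = Q^T D Q] is explicit once [Q = L C^-1], with [C] the
    smooth triangular factor. *)
Lemma smooth_phi : smooth_on_open setT (phi lam p).
Proof.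
have [C sC hC] := eigen_L_frame.
have oT : open [set: 'rV[R]_m] by exact: openT.
have sQ : smooth_entries setT (fun b => eigen_L lam p b *m invmx (C b)).
  apply: smooth_mulmx => //; first exact: smooth_eigen_L.
  apply: smooth_invmx => // b _; have [_ uC pC _] := hC b.
  by apply: upper_trig_unit => // i; rewrite gt_eqF.
apply: smooth_mx => //.
rewrite (_ : phi lam p = fun b => (eigen_L lam p b *m invmx (C b))^T *m D *m
  (eigen_L lam p b *m invmx (C b))); last first.
  by apply/funext => b; exact: (phi_QR lam_inj (hC b)).
do 2!apply: smooth_mulmx => //; first exact: smooth_trmx.
exact: smooth_cst_mx.
Qed.

Lemma smooth_gram_minor U k :
  open U -> smooth_on_open U (gram_minor lam p k).
Proof.
move=> oU; apply: smooth_det => // i j; under eq_fun do rewrite cornerE.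
case: (_ && _); last exact: smooth_cst.
by apply: smooth_horner_mx => // ? ?; exact: smooth_coord.
Qed.

Definition gram_pos : set 'M[R]_m.+1 :=
  [set T | forall k : 'I_m.+2, 0 < gram_minor lam p k T].

Lemma open_gram_pos : open gram_pos.
Proof.
rewrite openE => T posT.
have near_pos (k : 'I_m.+2) : \forall S \near T, 0 < gram_minor lam p k S.
  have cont : {for T, continuous (gram_minor lam p k)}.
    exact: (smooth_gram_minor k openT 0).
  by apply: (cvgr_gt _ cont); exact: posT.
exact: filter_forall near_pos.
Qed.

(** The square root of the [k]-th minor is [U_(0,0) ... U_(k-1,k-1)], so the ratio
    below is [U_(k+1,k+1) / U_(k,k)]; written with minors of [T], it is defined
    away from the chart domain. *)
Definition psi_ext (T : 'M[R]_m.+1) : 'rV[R]_m := \row_k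
  (T (sub_row k) (sub_col k) *
   (Num.sqrt (gram_minor lam p k.+2 T) * Num.sqrt (gram_minor lam p k T) /
    gram_minor lam p k.+1 T)).

Lemma smooth_psi_ext : smooth_on_open gram_pos psi_ext.
Proof.
have oG := open_gram_pos.
have sG k : smooth_on_open gram_pos (gram_minor lam p k).
  exact: smooth_gram_minor.
apply: smooth_mx => // i k; under eq_fun do rewrite mxE.
apply: smoothM => //; first exact: smooth_coord.
have pos j : (j < m.+2)%N -> forall T, gram_pos T -> 0 < gram_minor lam p j T.
  by move=> jm T /(_ (Ordinal jm)).
have km := ltn_ord k.
apply: smoothM => //; first apply: smoothM => //.
- by apply: smooth_sqrt => //; apply: pos; lia.
- by apply: smooth_sqrt => //; apply: pos; lia.
- apply: smoothV => // T /pos gT; rewrite gt_eqF // gT //; lia.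
Qed.

(** By [gram_minorE] the minors at [T] are squares of products of pivots of [Q],
    which are positive. *)
Lemma psi_extE T Q L U : tridiagonal T -> orthogonal_mx Q ->
  T = Q^T *m D *m Q -> is_LU Q L U -> (forall i, 0 < U i i) ->
  gram_pos T /\ psi lam p T = psi_ext T.
Proof.
move=> triT oQ TE QLU pU.
pose P k := \prod_(i < m.+1 | (i < k)%N) U i i.
have P0 k : 0 < P k by apply: prodr_gt0.
have GE k : gram_minor lam p k T = P k ^+ 2 := gram_minorE lam_inj k oQ TE QLU.
split=> [k|]; first by rewrite GE exprn_gt0.
have PS (i : 'I_m.+1) : P i.+1 = U i i * P i.
  rewrite /P (bigD1 i) //=; congr (_ * _); apply: eq_bigl => l.
  by rewrite ord_eqE; lia.
apply/rowP => k; rewrite [RHS]mxE (psi_corner lam_inj triT oQ TE QLU pU).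
rewrite !GE !sqrtr_sqr !gtr0_norm //.
have := PS (sub_row k); have := PS (sub_col k).
rewrite val_sub_row val_sub_col => -> ->; congr (_ * _).
have := P0 k; have := pU (sub_col k); rewrite !lt0r => /andP[u0 _] /andP[k0 _].
by field; rewrite k0 u0.
Qed.

End SmoothCharts.

Theorem theorem3p5 (R : realType) (m : nat) (hm : (2 <= m.+1)%N)
  (lam : 'I_m.+1 -> R)
  (hlam : forall i j : 'I_m.+1, (i < j)%N -> lam i < lam j)
  (p : {perm 'I_m.+1}) :
  diffeomorphism_with_inverse (@setT 'rV[R]_m) (chart_domain lam p)
    (phi lam p) (psi lam p).
Proof.
have lam_inj : injective lam.
  move=> i j lij; apply: val_inj; case: (ltngtP i j) => // /hlam.
    by rewrite lij ltxx.
  by rewrite lij ltxx.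
have [C _ QR] := @eigen_L_frame R m lam p.
split.
- by split=> // b _; exact (phi_in_chart lam_inj (QR b)).
- by move=> b _; exact (psi_phi lam_inj (QR b)).
- move=> T [[_ triT _] [Q [oQ [L [U [LU pU]]] TE]]].
  exact (phi_psi lam_inj triT oQ TE LU pU).
- move=> b _; exists setT, (phi lam p); split=> //; first exact: openT.
  exact: smooth_phi.
- have frame T : chart_domain lam p T ->
      gram_pos lam p T /\ psi lam p T = psi_ext lam p T.
    move=> [[_ triT _] [Q [oQ [L [U [LU pU]]] TE]]].
    exact (psi_extE lam_inj triT oQ TE LU pU).
  move=> T /frame[posT _]; exists (gram_pos lam p), (psi_ext lam p); split=> //.
  + exact: open_gram_pos.
  + exact: smooth_psi_ext.
  + by move=> S /frame[].
Qed.
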